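(* Let $R$ be an arbitrary (not necessarily unital) ring with stable rank one, and let $P, Q \in \mathcal{CP}(R)$ be countably generated projective right $R$-modules. Then: (i) $P \precsim Q$ if and only if $P$ is isomorphic to a pure submodule of $Q$. (ii) $P \sim Q$ if and only if $P \cong Q$.
   Context: Rings are associative, not necessarily unital unless stated. For an arbitrary ring $R$, $R^+ = \mathbb{Z}\oplus R$ denotes the Dorroh unitization, in which $R$ is a two-sided ideal. The ring $R$ has stable rank one, $\mathrm{sr}(R)=1$, if for all $a,b,x\in R^+$ with $a-1\in R$ and $xa+b=1$ there is $y\in R^+$ (equivalently $y \in R$) such that $a+yb$ is invertible in $R^+$. For unital $R$ this is equivalent to: for all $a,b\in R$ with $Ra+Rb=R$ there is $y\in R$ with $R(a+yb)=R$. $\mathcal{CP}(R)$ denotes the class of all countably generated unital projective right $R^+$-modules $P$ with $P=PR$; these are the ''countably generated projective right $R$-modules''. (For unital $R$ these are just the countably generated projective unital right $R$-modules.) Homomorphisms and submodules are those of right $R^+$-modules. For $P,Q\in\mathcal{CP}(R)$, Cuntz subequivalence $P\precsim Q$ means: for every finitely generated submodule $X$ of $P$ there are module homomorphisms $\phi\colon X\to Q$ and $\psi\colon Q\to P$ such that $\psi\circ\phi$ is the inclusion $X\hookrightarrow P$. Cuntz equivalence $P\sim Q$ means $P\precsim Q$ and $Q\precsim P$. A submodule $N$ of a right module $M$ over a unital ring $S$ (here $S=R^+$) is pure if for every left $S$-module $X$ the map $N\otimes_S X\to M\otimes_S X$ induced by inclusion is injective. (When $M$ is projective this is equivalent to: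 for every finitely generated submodule $F\subseteq N$ there is a homomorphism $\sigma\colon M\to N$ with $\sigma|_F=\mathrm{id}_F$.) *)

(* Defs.v *)
From HB Require Import structures.
From mathcomp Require Import all_boot all_order all_algebra.
From mathcomp Require Import boolp.
From mathcomp.multinomials Require Import freeg.

Set Implicit Arguments.
Unset Strict Implicit.
Unset Printing Implicit Defensive.

Import GRing.Theory.
Import Quotient.

Local Open Scope ring_scope.
Local Open Scope quotient_scope.

HB.mixin Record Zmodule_isRng R of GRing.Zmodule R := {
  rngM : R -> R -> R;
  rngMA : associative rngM;
  rngMDl : left_distributive rngM +%R;
  rngMDr : right_distributive rngM +%R
}.

#[short(type="rngType")]
HB.structure Definition Rng := {R of Zmodule_isRng R & GRing.Zmodule R}.

Section RngTheory.
Context (R : rngType).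
Implicit Types r s : R.

Lemma rngM_mulzl (n : int) r s : rngM (r *~ n) s = rngM r s *~ n.
Proof.
have add : zmod_morphism (fun r => rngM r s).
  move=> x y; apply: (addIr (rngM y s)).
  by rewrite -rngMDl !subrK.
pose f : {additive R -> R} :=
  HB.pack (fun r => rngM r s) (GRing.isZmodMorphism.Build _ _ _ add).
exact: (raddfMz f n).
Qed.

Lemma rngM_mulzr (n : int) r s : rngM r (s *~ n) = rngM r s *~ n.
Proof.
have add : zmod_morphism (rngM r).
  move=> x y; apply: (addIr (rngM r y)).
  by rewrite -rngMDr !subrK.
pose f : {additive R -> R} :=
  HB.pack (rngM r) (GRing.isZmodMorphism.Build _ _ _ add).
exact: (raddfMz f n).
Qed.

End RngTheory.

Definition dorroh (R : rngType) : Type := (int * R)%type.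

HB.instance Definition _ (R : rngType) := GRing.Zmodule.copy (dorroh R) (int * R)%type.

Section Dorroh.
Context (R : rngType).
Implicit Types a b c : dorroh R.

(* (m + r)(n + s) = mn + (nr + ms + rs) *)
Definition dorroh_mul a b : dorroh R :=
  (a.1 * b.1, a.2 *~ b.1 + b.2 *~ a.1 + rngM a.2 b.2).

Definition dorroh_one : dorroh R := (1, 0).

Lemma rngM0r (r : R) : rngM r 0 = 0.
Proof. by rewrite -(mulr0z 0) rngM_mulzr mulr0z. Qed.

Lemma rng0Mr (r : R) : rngM 0 r = 0.
Proof. by rewrite -(mulr0z 0) rngM_mulzl mulr0z. Qed.

Lemma dorroh_mulA : associative dorroh_mul.
Proof.
move=> [m r] [n s] [p t]; congr (_, _); rewrite /= ?mulrA //.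
rewrite !rngMDl !rngMDr !mulrzDl !rngM_mulzl !rngM_mulzr rngMA -!mulrzA.
rewrite [p * m]mulrC [n * m]mulrC -!addrA; congr (_ + (_ + _)).
rewrite [RHS]addrCA; congr (_ + _); rewrite addrCA [LHS]addrCA [RHS]addrCA.
by congr (_ + _); rewrite addrCA.
Qed.

Lemma dorroh_mul1 : left_id dorroh_one dorroh_mul.
Proof.
by move=> [m r]; congr (_, _); rewrite /= ?mul1r // mul0rz add0r rng0Mr addr0.
Qed.

Lemma dorroh_1mul : right_id dorroh_one dorroh_mul.
Proof.
by move=> [m r]; congr (_, _); rewrite /= ?mulr1 // mul0rz addr0 rngM0r addr0.
Qed.

Lemma dorroh_mulDl : left_distributive dorroh_mul +%R.
Proof.
move=> [m r] [n s] [p t]; congr (_, _); rewrite /= ?mulrDl //.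
by rewrite rngMDl mulrzDl mulrzDr (addrACA (r *~ p)) [LHS]addrACA.
Qed.

Lemma dorroh_mulDr : right_distributive dorroh_mul +%R.
Proof.
move=> [m r] [n s] [p t]; congr (_, _); rewrite /= ?mulrDr //.
by rewrite rngMDr mulrzDl mulrzDr (addrACA (r *~ n)) [LHS]addrACA.
Qed.

Lemma dorroh_one_neq0 : dorroh_one != 0.
Proof. by apply/eqP => -[]. Qed.

HB.instance Definition _ := GRing.Zmodule_isNzRing.Build (dorroh R)
  dorroh_mulA dorroh_mul1 dorroh_1mul dorroh_mulDl dorroh_mulDr dorroh_one_neq0.

Definition to_dorroh (r : R) : dorroh R := (0, r).

End Dorroh.

Definition invertible (S : pzRingType) (u : S) : Prop :=
  exists v : S, v * u = 1 /\ u * v = 1.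

Definition stable_rank_one (R : rngType) : Prop :=
  forall a b x : dorroh R,
    (exists r : R, a - 1 = to_dorroh r) -> x * a + b = 1 ->
    exists y : dorroh R, invertible (a + y * b).

(* Right S-modules are left modules over the converse ring; [(a : S^c) *: m]
   is the right action of a on m. *)
Notation rmodType S := (lmodType S^c).

Definition ract (S : pzRingType) (M : rmodType S) (m : M) (a : S) : M :=
  (a : S^c) *: m.

Definition isomorphic (S : pzRingType) (M N : lmodType S) : Prop :=
  exists f : {linear M -> N}, bijective f.

Definition finitely_generated (S : pzRingType) (M : lmodType S) : Prop :=
  exists (n : nat) (g : 'I_n -> M),
    forall x : M, exists c : 'I_n -> S, x = \sum_(i < n) c i *: g i.

Definition countably_generated (S : pzRingType) (M : lmodType S) : Prop :=
  exists g : nat -> M,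
    forall x : M, exists (n : nat) (c : 'I_n -> S), x = \sum_(i < n) c i *: g i.

Definition projective (S : pzRingType) (P : lmodType S) : Prop :=
  forall (M N : lmodType S) (g : {linear M -> N}) (f : {linear P -> N}),
    (forall y : N, exists x : M, g x = y) ->
    exists h : {linear P -> M}, forall p : P, g (h p) = f p.

(* The submodules of M are the [N : submodClosed M]. Their membership predicates
   are boolean, which classically is no restriction; [submod N] is N as a module. *)
Section Submodule.
Context (S : pzRingType) (M : lmodType S) (N : submodClosed M).

Record submod : Type := Submod { submod_val : M; submod_mem : submod_val \in N }.

HB.instance Definition _ := [isSub for submod_val].
HB.instance Definition _ := [Choice of submod by <:].
HB.instance Definition _ := [SubChoice_isSubLmodule of submod by <:].

Definition submod_incl : {linear submod -> M} := val.

End Submodule.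

Section Tensor.
Context (S : pzRingType) (M : rmodType S) (X : lmodType S).

Inductive tensor_rel : {freeg (M * X) / int} -> Prop :=
  | TensorRel0 : tensor_rel 0
  | TensorRelB u v : tensor_rel u -> tensor_rel v -> tensor_rel (u - v)
  | TensorRelDl m m' x :
      tensor_rel (<< (m + m', x) >> - (<< (m, x) >> + << (m', x) >>))
  | TensorRelDr m x x' :
      tensor_rel (<< (m, x + x') >> - (<< (m, x) >> + << (m, x') >>))
  | TensorRelZ m a x :
      tensor_rel (<< (ract m a, x) >> - << (m, a *: x) >>).

Definition tensor_relb : pred {freeg (M * X) / int} :=
  fun u => `[< tensor_rel u >].

Lemma tensor_relb_closed : zmod_closed tensor_relb.
Proof.
split=> [|u v /asboolP ru /asboolP rv]; apply/asboolP; first exact: TensorRel0.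
exact: TensorRelB.
Qed.

HB.instance Definition _ :=
  GRing.isZmodClosed.Build {freeg (M * X) / int} tensor_relb tensor_relb_closed.

Definition tensor : Type := {quot GRing.ZmodClosed.clone _ tensor_relb _}.

HB.instance Definition _ := GRing.Zmodule.on tensor.
HB.instance Definition _ := ZmodQuotient.on tensor.

Definition tens (m : M) (x : X) : tensor := \pi_tensor << (m, x) >>.

End Tensor.

Section TensorTheory.
Context (S : pzRingType).
Implicit Types (M N : rmodType S) (X : lmodType S).

Lemma pi_tensor_eq0 M X (u : {freeg (M * X) / int}) :
  tensor_rel u -> \pi_(tensor M X) u = 0.
Proof.
move=> ru; apply/eqP; rewrite -[0](raddf0 \pi_(tensor M X)).
by rewrite -idealrBE subr0; apply/asboolP.
Qed.

Lemma tensDl M X (m m' : M) (x : X) : tens (m + m') x = tens m x + tens m' x.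
Proof.
by apply/eqP; rewrite -subr_eq0 /tens -raddfD -raddfB /= pi_tensor_eq0 //;
  apply: TensorRelDl.
Qed.

Lemma tensDr M X (m : M) (x x' : X) : tens m (x + x') = tens m x + tens m x'.
Proof.
by apply/eqP; rewrite -subr_eq0 /tens -raddfD -raddfB /= pi_tensor_eq0 //;
  apply: TensorRelDr.
Qed.

Lemma tensZ M X (m : M) (a : S) (x : X) : tens (ract m a) x = tens m (a *: x).
Proof.
by apply/eqP; rewrite -subr_eq0 /tens -raddfB /= pi_tensor_eq0 //;
  apply: TensorRelZ.
Qed.

Definition tensor_gen N M (f : {linear N -> M}) X (p : N * X) :
    zmodule (tensor M X) :=
  tens (f p.1) p.2.

(* The map f (x) X : N (x) X -> M (x) X; see [tensor_map_tens] and
   [tensor_map_additive]. *)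
Definition tensor_map N M (f : {linear N -> M}) X (u : tensor N X) : tensor M X :=
  fglift (tensor_gen f (X := X)) (repr u).

Lemma tensor_map_pi N M (f : {linear N -> M}) X (u : {freeg (N * X) / int}) :
  tensor_map f (\pi_(tensor N X) u) = fglift (tensor_gen f (X := X)) u.
Proof.
rewrite /tensor_map; set F := tensor_gen _ (X := _).
have FB := lift_is_additive F.
have F1 p : fglift F << p >> = F p by rewrite liftU scale1r.
have FD v w : fglift F (v + w) = fglift F v + fglift F w.
  have FN z : fglift F (- z) = - fglift F z.
    by rewrite -[- z]sub0r FB -(subrr 0) FB subrr sub0r.
  by rewrite -[w in LHS]opprK FB FN opprK.
have F0 v : tensor_rel v -> fglift F v = 0.
  elim=> [|v1 v2 _ h1 _ h2|m m' x|m x x'|m a x].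
  - by rewrite -(subrr 0) FB subrr.
  - by rewrite FB h1 h2 subrr.
  - by rewrite FB FD !F1 /F /tensor_gen /= raddfD tensDl subrr.
  - by rewrite FB FD !F1 /F /tensor_gen /= tensDr subrr.
  - by rewrite FB !F1 /F /tensor_gen /= /ract linearZ /= -/(ract _ _) tensZ subrr.
apply/eqP; rewrite -subr_eq0 -FB F0 //; apply/asboolP.
have : repr (\pi_(tensor N X) u) - u \in GRing.ZmodClosed.clone _ (@tensor_relb _ N X) _.
  by rewrite idealrBE reprK.
by [].
Qed.

Lemma tensor_map_tens N M (f : {linear N -> M}) X (n : N) (x : X) :
  tensor_map f (tens n x) = tens (f n) x.
Proof. by rewrite tensor_map_pi liftU scale1r. Qed.

Lemma tensor_map_additive N M (f : {linear N -> M}) X :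
  zmod_morphism (@tensor_map N M f X).
Proof.
elim/quotW=> u; elim/quotW=> v; rewrite -raddfB !tensor_map_pi.
exact: (lift_is_additive (tensor_gen f (X := X))).
Qed.

End TensorTheory.

Definition pure (S : pzRingType) (M : rmodType S) (N : submodClosed M) : Prop :=
  forall X : lmodType S, injective (@tensor_map S _ _ (submod_incl N) X).

(* [P = PR] is the third conjunct; unitality is part of being an [lmodType]. *)
Definition CP (R : rngType) (P : rmodType (dorroh R)) : Prop :=
  [/\ countably_generated P, projective P &
      forall p : P, exists (n : nat) (q : 'I_n -> P) (r : 'I_n -> R),
        p = \sum_(i < n) ract (q i) (to_dorroh (r i))].

Definition cuntz_sub (S : pzRingType) (P Q : rmodType S) : Prop :=
  forall X : submodClosed P, finitely_generated (submod X) ->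
    exists (phi : {linear submod X -> Q}) (psi : {linear Q -> P}),
      forall x : submod X, psi (phi x) = submod_incl X x.

Definition cuntz_equiv (S : pzRingType) (P Q : rmodType S) : Prop :=
  cuntz_sub P Q /\ cuntz_sub Q P.

(* Main.v *)
From HB Require Import structures.
Require Import Defs.
From mathcomp Require Import all_boot all_order all_algebra.
From mathcomp Require Import boolp.
From mathcomp.multinomials Require Import freeg.

Set Implicit Arguments.
Unset Strict Implicit.
Unset Printing Implicit Defensive.

Import GRing.Theory.
Import Quotient.

Local Open Scope ring_scope.
Local Open Scope quotient_scope.

(** Why the theorem holds. Everything is phrased with locally split maps:
linear maps P -> Q that on each finite subset of P are undone by some linear
map Q -> P.

- The inclusion of a submodule N of a countably generated projective Q is
  locally split exactly when N is pure. A locally split map stays injective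
  after tensoring because an element of a tensor product involves finitely
  many elements ([tensor_map_locally_split]). Conversely a dual basis of Q writes
  finitely many elements of N as a linear system solved in Q; tensoring with the
  cokernel of the matrix of the system shows that purity provides a solution
  in N ([tens_coker_eq0]), and the dual basis turns that solution into a
  retraction ([pure_locally_split]).

- A locally split map gives Cuntz subequivalence at once. The converse is where
  stable rank one enters. Cuntz subequivalence provides, for each finite subset
  of P, a finite rank map P -> Q with a left inverse on that subset, but the
  maps obtained for growing subsets need not be compatible. They become so
  after composition with automorphisms of Q: if f, f' : P -> Q have left
  inverses g, g' on a finite set, the endomorphism a = f' g carries f p to f' p
  for p in that set, and x = f g' carries f' p back to f p. If f' has finite
  rank, so has a, and stable rank one deforms a into an automorphism without
  changing it where x a is the identity ([finite_rank_completion]).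

- Hence a finite partial isomorphism that extends to a pair of linear maps,
  mutually inverse on it, can be enlarged by any element of P
  ([partial_inverse_extend]). Running through a countable generating sequence
  of P gives in the limit a locally split P -> Q
  ([cuntz_sub_locally_split]). If also Q is subequivalent to P, enlarging
  alternately by generators of P and of Q gives an isomorphism
  ([cuntz_equiv_isomorphic]).

Stable rank one passes by induction on the rank from R to those finite rank
endomorphisms of a module that are built from functionals with values in R. The
rank one case rests on the fact that 1 + q f is invertible as soon as the scalar
1 + f q is ([add_rank1_bijective], [stable_rank1]). *)

(** * Linear maps *)

Section LinearMaps.
Context (A : pzRingType).
Implicit Types M N : lmodType A.

Definition linear_of M N (f : M -> N) (fL : linear f) : {linear M -> N} :=
  HB.pack f (GRing.isLinear.Build A M N _ f fL).

Definition scalar_of M (f : M -> A) (fL : scalar f) : {scalar M} :=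
  HB.pack f (GRing.isLinear.Build A M A *%R f fL).

Definition rank1 M N (f : {scalar M}) (q : N) : M -> N := fun v => f v *: q.

Lemma rank1_linear M N (f : {scalar M}) (q : N) : linear (rank1 f q).
Proof. by move=> a u v; rewrite /rank1 linearP scalerDl scalerA. Qed.

HB.instance Definition _ M N (f : {scalar M}) (q : N) :=
  GRing.isLinear.Build A M N _ (rank1 f q) (rank1_linear f q).

Lemma finite_rank_linear M N (f : nat -> {scalar M}) (q : nat -> N) n :
  linear (fun v => \sum_(i < n) f i v *: q i).
Proof.
move=> a u v; rewrite scaler_sumr -big_split; apply: eq_bigr => i _ /=.
exact: (rank1_linear (f i) (q i)).
Qed.

Definition finite_rank M N (f : nat -> {scalar M}) (q : nat -> N) n :
  {linear M -> N} := linear_of (finite_rank_linear f q n).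

Lemma inverse_linear M N (f : {linear M -> N}) (g : N -> M) :
  cancel f g -> cancel g f -> linear g.
Proof. by move=> fK gK a u v; apply: (can_inj fK); rewrite gK linearP !gK. Qed.

End LinearMaps.

(** * Stable rank one for finite rank endomorphisms *)

Section StableEndomorphisms.
Context (A : pzRingType) (I : A -> Prop).
(** In the application A is the converse of R^+ and I is membership in R. *)
Hypothesis stableI : forall a b x : A,
  I (a - 1) -> a * x + b = 1 -> exists y, invertible (a + b * y).

(** The analogue, for one element a of the endomorphism ring, of the stable rank
one condition: x a + b = 1 implies that some a + y b is invertible. *)
Definition stable_endo (Q : lmodType A) (a : {linear Q -> Q}) : Prop :=
  forall x b : {linear Q -> Q}, (forall v, x (a v) + b v = v) ->
  exists y u w : {linear Q -> Q},
    [/\ cancel u w, cancel w u & forall v, u v = a v + y (b v)].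

(** The inverse of v |-> v + (f v) q is v |-> v - (f v) t q, for t the inverse
of 1 + f q. *)
Lemma add_rank1_bijective (Q : lmodType A) (f : {scalar Q}) (q : Q) :
  invertible (1 + f q) ->
  exists w : {linear Q -> Q},
    cancel (idfun \+ rank1 f q) w /\ cancel w (idfun \+ rank1 f q).
Proof.
case=> t [t1 t2]; exists (idfun \- rank1 f (t *: q)).
split=> v; rewrite /= /rank1.
- have -> : f (v + f v *: q) = f v * (1 + f q).
    by rewrite linearD linearZ mulrDr mulr1.
  by rewrite scalerA -mulrA t2 mulr1 addrK.
- have -> : f (v - f v *: (t *: q)) = f v * t.
    rewrite raddfB /= linearZ linearZ /= -{1}[f v]mulr1 -mulrBr.
    by congr (_ * _); rewrite -t1 mulrDr mulr1 addrK.
  by rewrite scalerA subrK.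
Qed.

(** Applying f to the relation x a + b = 1 at q turns it into a relation between
scalars, whose stable rank one completion 1 + f q - f (b q) y is again of the
form 1 + k q, with k v = f v - f (b v) y. The endomorphism v |-> v + (k v) q is
then the sought automorphism. *)
Lemma stable_rank1 (Q : lmodType A) (f : {scalar Q}) (q : Q) :
  (forall v, I (f v)) -> stable_endo (idfun \+ rank1 f q).
Proof.
move=> fI x b xab; pose s := f q.
have aq : q + s *: q = (1 + s) *: q by rewrite scalerDl scale1r.
have sb : (1 + s) * (1 - f (x q)) + - f (b q) = 1.
  have /(congr1 f) := xab q; rewrite /= /rank1 aq raddfD linearZ /= linearZ /=.
  by rewrite -/s => e; rewrite mulrBr mulr1 -addrA -opprD e addrK.
have [|y sy] := stableI _ sb; first by rewrite addrC addKr; apply: fI.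
pose k_ v := f v - f (b v) * y.
have kL : scalar k_.
  by move=> c u v; rewrite /k_ !linearP /= mulrDl opprD addrACA -mulrA -mulrBr.
pose k : {scalar Q} := scalar_of kL.
pose yf_ v := f v * y.
have yfL : scalar yf_.
  by move=> c u v; rewrite /yf_ linearP /= mulrDl mulrA.
pose yf : {scalar Q} := scalar_of yfL.
have [|w [kw wk]] := @add_rank1_bijective Q k q.
  by rewrite /= /k_ -mulNr addrA.
exists (rank1 yf (- q)), (idfun \+ rank1 k q), w; split=> // v.
by rewrite /= /rank1 /= /k_ /yf_ scalerN scalerBl addrA.
Qed.

(** Let a = c + q f with c of smaller rank. From x c + (x q f + b) = 1 induction
gives an automorphism u = c + y (x q f + b), and a + y b equals
u + (1 - y x) q f = u d, where d is a rank one perturbation of 1 and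
(x u) d + (1 - x y) b = 1. *)
Lemma stable_finite_rank (Q : lmodType A) (f : nat -> {scalar Q})
    (q : nat -> Q) n (a : {linear Q -> Q}) :
  (forall i v, I (f i v)) -> (forall v, a v = v + finite_rank f q n v) ->
  stable_endo a.
Proof.
move=> fI; elim: n a => [|n IHn] a aE x b xab.
  exists \0, idfun, idfun; split=> // v.
  by rewrite aE /= big_ord0 !addr0.
pose c : {linear Q -> Q} := idfun \+ finite_rank f q n.
pose fn := rank1 (f n) (q n).
have {}aE v : a v = c v + fn v by rewrite aE /= big_ord_recr /= addrA.
have [v|y1 [u [w [uw wu uE]]]] := IHn c (fun=> erefl) x ((x \o fn) \+ b).
  by rewrite -[RHS]xab aE /= addrA -linearD.
pose r := w (q n - y1 (x (q n))).
pose d : {linear Q -> Q} := idfun \+ rank1 (f n) r.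
have udE v : u (d v) = a v + y1 (b v).
  rewrite aE /= /rank1 linearD linearZ wu uE /= /fn /rank1.
  rewrite linearD !linearZ /= scalerBr -!addrA; congr (_ + (_ + _)).
  by rewrite addrCA [X in _ + X]addrC subrK addrC.
have [v|z [u2 [w2 [uw2 wu2 u2E]]]] :=
  @stable_rank1 Q (f n) r (fI n) (x \o u) ((idfun \- (x \o y1)) \o b).
  change (x (u (d v)) + (b v - x (y1 (b v))) = v).
  by rewrite udE linearD addrACA xab subrr addr0.
exists (y1 \+ (u \o (z \o (idfun \- (x \o y1))))), (u \o u2), (w2 \o w).
split=> [v|v|v] /=; rewrite ?uw ?wu2 //.
by rewrite u2E linearD -/(d v) udE /= addrA.
Qed.

(** With b = 1 - x a, the endomorphism a + b = 1 + (1 - x) a is a finite rank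
perturbation of 1 and x (a + b) + (1 - x) b = 1, so a + b + y (1 - x) b is an
automorphism for some y; it agrees with a where b vanishes. *)
Lemma finite_rank_completion (Q : lmodType A) (f : nat -> {scalar Q})
    (q : nat -> Q) n (x : {linear Q -> Q}) :
  (forall i v, I (f i v)) ->
  exists u w : {linear Q -> Q}, [/\ cancel u w, cancel w u &
    forall v, x (finite_rank f q n v) = v -> u v = finite_rank f q n v].
Proof.
move=> fI; pose a := finite_rank f q n.
pose b : {linear Q -> Q} := idfun \- (x \o a).
pose q' i := q i - x (q i).
pose a1 : {linear Q -> Q} := a \+ b.
have a1E v : a1 v = v + finite_rank f q' n v.
  rewrite /= addrCA; congr (_ + _).
  rewrite linear_sum -sumrB; apply: eq_bigr => i _.
  by rewrite scalerBr linearZ.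
have [v|y [u [w [uw wu uE]]]] :=
    stable_finite_rank fI a1E (x := x) (b := (idfun \- x) \o b).
  change (x (a v + b v) + (b v - x (b v)) = v).
  by rewrite linearD addrACA subrr addr0 /= addrC subrK.
exists u, w; split=> // v xav.
have bv : b v = 0 by rewrite /= xav subrr.
rewrite uE; change (a v + b v + y (b v - x (b v)) = a v).
by rewrite bv linear0 subrr linear0 !addr0.
Qed.

End StableEndomorphisms.

(** * Images and locally split maps *)

Section Image.
Context (A : pzRingType) (M N : lmodType A) (f : {linear M -> N}).

Definition image_pred : pred N := fun y => `[< exists v, f v = y >].

Lemma image_submod_closed : submod_closed image_pred.
Proof.
split=> [|a _ _ /asboolP[u <-] /asboolP[v <-]]; apply/asboolP.
  by exists 0; rewrite linear0.
by exists (a *: u + v); rewrite linearP.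
Qed.

HB.instance Definition _ :=
  GRing.isSubmodClosed.Build A N image_pred image_submod_closed.

Definition image_submod : submodClosed N :=
  GRing.SubmodClosed.clone A N image_pred _.

Lemma mem_image v : f v \in image_submod.
Proof. by apply/asboolP; exists v. Qed.

Definition corestr_fun v : submod image_submod := Submod (mem_image v).

Lemma corestr_linear : linear corestr_fun.
Proof. by move=> a u v; apply: val_inj; rewrite /= linearP. Qed.

Definition corestr : {linear M -> submod image_submod} :=
  linear_of corestr_linear.

Lemma corestr_surj y : exists v, corestr v = y.
Proof.
case: y => y iy; have /asboolP[v fv] := iy; exists v.
by apply: val_inj.
Qed.

End Image.

Section LocallySplit.
Context (A : pzRingType).
Implicit Types M N : lmodType A.

Definition locally_split M N (f : {linear M -> N}) : Prop :=
  forall s : seq M, exists g : {linear N -> M}, {in s, forall v, g (f v) = v}.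

Lemma locally_split_inj M N (f : {linear M -> N}) :
  locally_split f -> injective f.
Proof.
move=> fs u v fuv; have [g gf] := fs [:: u; v].
by rewrite -(gf u) ?fuv ?gf // !inE eqxx ?orbT.
Qed.

Lemma bij_linear_inverse M N (f : {linear M -> N}) :
  bijective f -> exists g : {linear N -> M}, cancel f g /\ cancel g f.
Proof. by case=> g fK gK; exists (linear_of (inverse_linear fK gK)). Qed.

Lemma inj_surj_bijective M N (f : {linear M -> N}) :
  injective f -> (forall y, exists x, f x = y) -> bijective f.
Proof.
move=> finj /choice[g fg]; exists g => // x.
by apply: finj; rewrite fg.
Qed.

(** The corestriction of f to its image is an isomorphism, so the splittings of
f can be moved to the inclusion of the image. *)
Lemma locally_split_corestr M N (f : {linear M -> N}) :
  locally_split f ->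
  isomorphic M (submod (image_submod f)) /\
  locally_split (submod_incl (image_submod f)).
Proof.
move=> fs.
have cb : bijective (corestr f).
  apply: inj_surj_bijective (@corestr_surj _ _ _ f) => u v /(congr1 val).
  exact: (locally_split_inj fs).
split; first by exists (corestr f).
have [c' [cK c'K]] := bij_linear_inverse cb.
move=> s; have [g gf] := fs [seq c' y | y <- s].
exists (corestr f \o g) => y ys /=.
rewrite -{1}(c'K y) /= gf ?map_f //; exact: c'K.
Qed.

Lemma locally_split_iso M N N' (f : {linear N -> N'}) :
  isomorphic M N -> locally_split f ->
  exists f' : {linear M -> N'}, locally_split f'.
Proof.
case=> e eb fs; have [e' [eK e'K]] := bij_linear_inverse eb.
exists (f \o e) => s; have [g gf] := fs [seq e v | v <- s].
by exists (e' \o g) => v vs /=; rewrite gf ?eK ?map_f.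
Qed.

Lemma eq_on_generators M N n (p : 'I_n -> M) (f g : {linear M -> N}) c :
  (forall i, f (p i) = g (p i)) ->
  f (\sum_(i < n) c i *: p i) = g (\sum_(i < n) c i *: p i).
Proof.
by move=> fg; rewrite !linear_sum; apply: eq_bigr => i _; rewrite !linearZ fg.
Qed.

End LocallySplit.

(** * Tensor products and local splittings *)

Section Pure.
Context (S : pzRingType).
Implicit Types (M N : rmodType S) (X : lmodType S).

Lemma tens0l M X (x : X) : tens (0 : M) x = 0.
Proof. by apply: (addIr (tens 0 x)); rewrite -tensDl !add0r. Qed.

Lemma tens0r M X (m : M) : tens m (0 : X) = 0.
Proof. by apply: (addIr (tens m 0)); rewrite -tensDr !add0r. Qed.

Lemma tens_suml M X n (F : 'I_n -> M) (x : X) :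
  tens (\sum_(i < n) F i) x = \sum_(i < n) tens (F i) x.
Proof.
exact: (big_morph _ (fun a b => tensDl a b x) (tens0l M x)).
Qed.

Lemma tens_sumr M X n (m : M) (F : 'I_n -> X) :
  tens m (\sum_(i < n) F i) = \sum_(i < n) tens m (F i).
Proof.
exact: (big_morph _ (tensDr m) (tens0r X m)).
Qed.

Lemma tens_opp M X (m : M) (x : X) : tens (- m) x = - tens m x.
Proof.
by apply: (addIr (tens m x)); rewrite -tensDl !addNr tens0l.
Qed.

Lemma tensor_sum M X (w : tensor M X) :
  exists s : seq (M * X), w = \sum_(z <- s) tens z.1 z.2.
Proof.
pose sumP (t : tensor M X) :=
  exists s : seq (M * X), t = \sum_(z <- s) tens z.1 z.2.
have sum0 : sumP 0 by exists [::]; rewrite big_nil.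
have sumD t1 t2 : sumP t1 -> sumP t2 -> sumP (t1 + t2).
  by move=> [s1 ->] [s2 ->]; exists (s1 ++ s2); rewrite big_cat.
have sumN t : sumP t -> sumP (- t).
  move=> [s ->]; exists [seq (- z.1, z.2) | z <- s].
  by rewrite big_map -sumrN; apply: eq_bigr => z _; rewrite tens_opp.
have sumMn t n : sumP t -> sumP (t *+ n).
  by move=> st; elim: n => [|n IHn]; rewrite ?mulr0n ?mulrS //; apply: sumD.
have sumMz t k : sumP t -> sumP (t *~ k).
  move=> st; case: k => n; first exact: sumMn.
  by rewrite NegzE mulrNz; apply/sumN/sumMn.
elim/quotW: w => u; elim/freeg_ind_dom0: u => [|k [m x] u _ _ su].
  by rewrite raddf0.
rewrite raddfD; apply: sumD su.
have -> : << k *g (m, x) >> = << (m, x) >> *~ k :> {freeg (M * X) / int}.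
  by rewrite freegU_mulz intz.
rewrite raddfMz; apply: sumMz.
by exists [:: (m, x)]; rewrite big_seq1.
Qed.

Definition tensor_mapA M N (f : {linear N -> M}) X :
    {additive tensor N X -> tensor M X} :=
  HB.pack (@tensor_map S N M f X)
    (GRing.isZmodMorphism.Build _ _ _ (tensor_map_additive f (X := X))).

(** A tensor in the kernel is a finite sum of pure tensors, and a splitting that
is valid on their first components recovers it from its image, zero. *)
Lemma tensor_map_locally_split M N (f : {linear N -> M}) X :
  locally_split f -> injective (@tensor_map S N M f X).
Proof.
move=> fs; apply: (raddf_inj (f := tensor_mapA f X)) => w w0.
have [s ws] := tensor_sum w; have [g gf] := fs [seq z.1 | z <- s].
rewrite -(raddf0 (tensor_mapA g X)) -w0 {}ws !raddf_sum.
rewrite !big_seq; apply: eq_bigr => z zs.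
by rewrite /= !tensor_map_tens gf // map_f.
Qed.

End Pure.

(** * Quotient modules *)

Section QuotientModule.
Context (S : pzRingType) (V : lmodType S) (K : submodClosed V).

(** The quotient is indexed by an additive subgroup, so K is first seen as one;
closure under opposites comes from scaling by -1. *)
Definition submod_pred : pred V := fun v => v \in K.

HB.instance Definition _ := GRing.isZmodClosed.Build V submod_pred
  (GRing.submod_closedB (GRing.submodClosedP K)).

Definition submod_zmod : zmodClosed V :=
  GRing.ZmodClosed.clone V submod_pred _.

Definition quot_module : Type := {quot submod_zmod}.

HB.instance Definition _ := GRing.Zmodule.on quot_module.
HB.instance Definition _ := ZmodQuotient.on quot_module.

Definition quot_scale (a : S) (x : quot_module) : quot_module :=
  \pi_quot_module (a *: repr x).

Lemma pi_quot_scale a v :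
  \pi_quot_module (a *: v) = quot_scale a (\pi_quot_module v).
Proof.
(* The representative of the class of v differs from v by an element of K,
   which a keeps in K. *)
apply/eqP.
rewrite -idealrBE -scalerBr; apply: (rpredZ (s := K)).
have := idealrBE submod_zmod v (repr (\pi_quot_module v)).
by rewrite [X in _ == X]reprK eqxx.
Qed.

Lemma quot_scaleA a b x :
  quot_scale a (quot_scale b x) = quot_scale (a * b) x.
Proof.
by elim/quotW: x => v; rewrite -(pi_quot_scale b v) -!pi_quot_scale scalerA.
Qed.

Lemma quot_scale1 : left_id 1 quot_scale.
Proof. by elim/quotW=> v; rewrite -pi_quot_scale scale1r. Qed.

Lemma quot_scaleDr : right_distributive quot_scale +%R.
Proof.
move=> a; elim/quotW=> u; elim/quotW=> v.
by rewrite -raddfD -!pi_quot_scale scalerDr raddfD.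
Qed.

Lemma quot_scaleDl x : {morph quot_scale^~ x : a b / a + b}.
Proof.
by elim/quotW: x => v a b; rewrite -!pi_quot_scale scalerDl raddfD.
Qed.

HB.instance Definition _ := GRing.Zmodule_isLmodule.Build S quot_module
  quot_scaleA quot_scale1 quot_scaleDr quot_scaleDl.

Definition quot_proj : V -> quot_module := \pi_quot_module.

Lemma quot_proj_linear : linear quot_proj.
Proof.
move=> a u v; rewrite /quot_proj raddfD; congr (_ + _).
exact: pi_quot_scale.
Qed.

HB.instance Definition _ :=
  GRing.isLinear.Build S V quot_module _ quot_proj quot_proj_linear.

Lemma quot_proj_eq0 v : (quot_proj v == 0) = (v \in K).
Proof. by rewrite -(raddf0 quot_proj) -idealrBE subr0. Qed.

Lemma quot_projK x : quot_proj (repr x) = x.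
Proof. exact: reprK. Qed.

End QuotientModule.

(** * Pure submodules of projective modules *)

Section PureLocallySplit.
Context (S : pzRingType).

Lemma tensor_eq0_rel (M : rmodType S) (X : lmodType S)
    (u : {freeg (M * X) / int}) :
  \pi_(tensor M X) u = 0 -> tensor_rel u.
Proof.
move/eqP; rewrite -[0](raddf0 \pi_(tensor M X)) -idealrBE subr0.
by move/asboolP.
Qed.

(** The part of right exactness of the tensor product that purity needs: for
the row space K of s, the kernel of N^k -> N (x) S^k/K consists of the
n' s with n' in N^m. *)
Lemma tens_coker_eq0 (N : rmodType S) m k (s : 'M[S]_(m, k)) (n : 'I_k -> N) :
  let L := quot_module (image_submod (mulmxr s : {linear 'rV_m -> 'rV_k})) in
  \sum_(j < k) tens (n j) (quot_proj _ (delta_mx 0 j) : L) = 0 ->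
  exists n' : 'I_m -> N, forall j, n j = \sum_(i < m) ract (n' i) (s i j).
Proof.
move=> L.
(* NK is N^m s; lifting an element of S^k/K to a representative gives a map
   from N x S^k/K to N^k which is balanced modulo NK, and hence sends every
   defining relation of the tensor product into NK. *)
pose NK (w : 'rV[N]_k) := exists n' : 'I_m -> N,
  forall j, w 0 j = \sum_(i < m) ract (n' i) (s i j).
have NKB w1 w2 : NK w1 -> NK w2 -> NK (w1 - w2).
  move=> [n1 e1] [n2 e2]; exists (fun i => n1 i - n2 i) => j.
  by rewrite !mxE e1 e2 -sumrB; apply: eq_bigr => i _; rewrite /ract scalerBr.
have NK0 : NK 0.
  by exists (fun=> 0) => j; rewrite mxE big1 // => i _; rewrite /ract scaler0.
pose F1 (a : N) (v : 'rV[S]_k) : 'rV[N]_k := \row_j ract a (v 0 j).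
have F1Dl a b v : F1 (a + b) v = F1 a v + F1 b v.
  by apply/rowP => j; rewrite !mxE /ract scalerDr.
have F1Dr a u v : F1 a (u + v) = F1 a u + F1 a v.
  by apply/rowP => j; rewrite !mxE /ract scalerDl.
have F1B a u v : F1 a (u - v) = F1 a u - F1 a v.
  by apply: (addIr (F1 a v)); rewrite -F1Dr !subrK.
have NKF a u v : quot_proj _ u = quot_proj _ v :> L -> NK (F1 a u - F1 a v).
  move=> /eqP; rewrite -subr_eq0 -raddfB quot_proj_eq0 => /asboolP[c /= cE].
  exists (fun i => ract a (c 0 i)) => j; rewrite -F1B -cE !mxE.
  by rewrite /ract scaler_suml; apply: eq_bigr => i _; rewrite scalerA.
pose F (z : N * L) : zmodule 'rV[N]_k := F1 z.1 (repr z.2).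
pose T : {freeg (N * L) / int} -> zmodule 'rV[N]_k := fglift F.
have TB : zmod_morphism T by exact: lift_is_additive.
have T1 z : T << z >> = F z by rewrite /T liftU scale1r.
pose TA : {additive {freeg (N * L) / int} -> zmodule 'rV[N]_k} :=
  HB.pack T (GRing.isZmodMorphism.Build _ _ _ TB).
have T0 : T 0 = 0 by exact: (raddf0 TA).
have TD : {morph T : x y / x + y} by exact: (raddfD TA).
have NKT u : tensor_rel u -> NK (T u).
  elim=> [|v1 v2 _ h1 _ h2|a b x|a x y|a c x].
  - by rewrite T0.
  - by rewrite TB; apply: NKB.
  - rewrite TB TD !T1 /F /= F1Dl.
    by rewrite [X in NK X](_ : _ = 0) // subrr.
  - rewrite TB TD !T1 /F /= -F1Dr; apply: NKF.
    by rewrite linearD /= !quot_projK.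
  - rewrite TB !T1 /F /=.
    have -> : F1 (ract a c) (repr x) = F1 a (c *: repr x).
      by apply/rowP => j; rewrite !mxE /ract scalerA.
    by apply: NKF; rewrite linearZ /= !quot_projK.
move=> s0.
(* The value at the given tensor differs from n by an element of NK, since
   the representatives of the basis vectors are correct modulo K. *)
have rel0 : tensor_rel
    (\sum_(j < k) << (n j, quot_proj _ (delta_mx 0 j) : L) >>).
  by apply: tensor_eq0_rel; rewrite raddf_sum.
have := NKT _ rel0; rewrite (big_morph T TD T0) => NK1.
have NKs (G : 'I_k -> 'rV[N]_k) : (forall j, NK (G j)) -> NK (\sum_j G j).
  move=> NKG; apply: big_ind => // x y nx ny.
  by rewrite -[y]opprK -[- y]sub0r; apply: (NKB) => //; apply: NKB.
have NKd j : NK (F1 (n j) (repr (quot_proj _ (delta_mx 0 j) : L)) -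
                 F1 (n j) (delta_mx 0 j)).
  exact/NKF/quot_projK.
have := NKB _ _ NK1 (NKs _ NKd).
rewrite -sumrB => -[n' n'E]; exists n' => j.
rewrite -n'E summxE (bigD1 j) //= T1 /F /= opprB addrCA subrr addr0.
rewrite big1 => [|i ij]; first by rewrite !mxE !eqxx /= /ract scale1r addr0.
rewrite T1 /F /= opprB addrCA subrr addr0.
by rewrite !mxE /= eq_sym (negPf ij) /ract scale0r.
Qed.

(** The elements n_j of N to be fixed satisfy n_j = sum_i e_i c_ij in Q, with
c_ij = h_i n_j. Thus sum_j n_j (x) [delta_j] is zero in Q (x) coker c, by purity
in N (x) coker c, and there are n'_i in N with n_j = sum_i n'_i c_ij. The
retraction sends v to sum_i n'_i (h_i v). *)
Lemma pure_locally_split (Q : rmodType S) (N : submodClosed Q)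
    (h : nat -> {scalar Q}) (e : nat -> Q) :
  (forall s : seq Q, exists m, {in s, forall v, finite_rank h e m v = v}) ->
  pure N -> locally_split (submod_incl N).
Proof.
move=> heQ pureN s; have [m hem] := heQ [seq submod_incl N y | y <- s].
pose k := size s; pose n (j : 'I_k) := tnth (in_tuple s) j.
pose c : 'M[S]_(m, k) := \matrix_(i, j) h i (submod_incl N (n j)).
pose L := quot_module (image_submod (mulmxr c : {linear 'rV_m -> 'rV_k})).
have s0 : \sum_(j < k) tens (n j) (quot_proj _ (delta_mx 0 j) : L) = 0.
  apply: (pureN L).
  rewrite -[LHS]/(tensor_mapA (submod_incl N) L _).
  rewrite -[RHS]/(tensor_mapA (submod_incl N) L 0) raddf0 raddf_sum /=.
  transitivity (\sum_(j < k) \sum_(i < m)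
      tens (e i) (c i j *: quot_proj _ (delta_mx 0 j) : L)).
    apply: eq_bigr => j _.
    rewrite tensor_map_tens -[in LHS](hem (submod_incl N (n j))); last first.
      by rewrite map_f ?mem_tnth.
    by rewrite /= tens_suml; apply: eq_bigr => i _; rewrite mxE -tensZ.
  rewrite exchange_big big1 // => i _; rewrite -tens_sumr.
  suff -> : \sum_j c i j *: quot_proj _ (delta_mx 0 j) = 0 :> L.
    exact: tens0r.
  under eq_bigr do rewrite -linearZ.
  rewrite -linear_sum /=; apply/eqP; rewrite quot_proj_eq0; apply/asboolP.
  exists (delta_mx 0 i); rewrite /= -rowE [row i c]row_sum_delta.
  by apply: eq_bigr => j _; rewrite mxE.
have [n' n'E] := tens_coker_eq0 s0.
exists (finite_rank h (fun i => oapp n' 0 (insub i)) m).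
move=> y /(tnthP (in_tuple s))[j ->].
by rewrite [RHS]n'E; apply: eq_bigr => i _; rewrite valK mxE.
Qed.

End PureLocallySplit.

(** * Dual bases *)

Lemma eventually_seq (T : eqType) (P : T -> nat -> Prop) (s : seq T) :
  (forall x, exists N, forall n, (N <= n)%N -> P x n) ->
  exists N, forall n, (N <= n)%N -> {in s, forall x, P x n}.
Proof.
move=> ev; elim: s => [|x s [N sN]]; first by exists 0%N.
have [N' xN] := ev x; exists (maxn N' N) => n; rewrite geq_max => /andP[n1 n2].
by move=> y; rewrite inE => /predU1P[->|]; [apply: xN | apply: sN].
Qed.

(** {poly A} serves as the free module of countable rank: a section of the
surjection X^i |-> e i has as coordinates the coefficients of a polynomial. *)
Lemma dual_basis (A : nzRingType) (P : lmodType A) :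
  countably_generated P -> projective P ->
  exists (h : nat -> {scalar P}) (e : nat -> P),
    forall v, exists N, forall n, (N <= n)%N -> finite_rank h e n v = v.
Proof.
move=> [e eP] projP.
pose g_ (p : {poly A}) := \sum_(i < size p) p`_i *: e i.
have gE n (p : {poly A}) : (size p <= n)%N -> g_ p = \sum_(i < n) p`_i *: e i.
  move=> pn; rewrite /g_ (big_ord_widen n (fun i => p`_i *: e i) pn).
  rewrite big_mkcond; apply: eq_bigr => i _; case: ltnP => // pi.
  by rewrite nth_default ?scale0r.
have gL : linear g_.
  move=> a p q; pose n := maxn (size (a *: p + q)) (maxn (size p) (size q)).
  rewrite !(gE n) ?leq_max ?leqnn ?orbT // scaler_sumr -big_split.
  by apply: eq_bigr => i _; rewrite coefD coefZ scalerDl scalerA.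
pose g : {linear {poly A} -> P} := linear_of gL.
have [v|h hP] := projP {poly A} P g idfun.
  have [n [c ->]] := eP v; exists (\poly_(i < n) oapp c 0 (insub i)).
  rewrite [LHS](gE n) ?size_poly //; apply: eq_bigr => i _.
  by rewrite coef_poly ltn_ord valK.
exists (fun i => coefp i \o h : {scalar P}), e => v.
exists (size (h v)) => n hn.
by rewrite -[RHS]hP /= (gE n).
Qed.

Lemma dual_basis_seq (A : nzRingType) (P : lmodType A) :
  countably_generated P -> projective P ->
  exists (h : nat -> {scalar P}) (e : nat -> P),
    forall s : seq P, exists m, {in s, forall v, finite_rank h e m v = v}.
Proof.
move=> cgP projP; have [h [e he]] := dual_basis cgP projP.
exists h, e => s; have [m mP] := eventually_seq s he.
by exists m; apply: mP.
Qed.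

(** * Sequences of linear maps *)

Lemma limit_linear (A : pzRingType) (M N : lmodType A)
    (f : nat -> {linear M -> N}) :
  (forall v, exists n0, forall n, (n0 <= n)%N -> f n v = f n0 v) ->
  exists phi : {linear M -> N},
    forall v, exists n0, forall n, (n0 <= n)%N -> f n v = phi v.
Proof.
move=> /choice[n0 fst].
have phiL : linear (fun v => f (n0 v) v).
  move=> a u v; set w := a *: u + v.
  pose n := maxn (n0 w) (maxn (n0 u) (n0 v)).
  rewrite -(fst w n) -?(fst u n) -?(fst v n) ?leq_max ?leqnn ?orbT //.
  exact: linearP.
by exists (linear_of phiL) => v; exists (n0 v) => n; apply: fst.
Qed.

Lemma dependent_chain (T : Type) (G : T -> Prop) (E : nat -> T -> T -> Prop) :
  (exists t, G t) -> (forall n t, G t -> exists t', G t' /\ E n t t') ->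
  exists c : nat -> T, forall n, G (c n) /\ E n (c n) (c n.+1).
Proof.
move=> [t0 G0] step.
have /choice[F FP] : forall nt : nat * T, exists t',
    G nt.2 -> G t' /\ E nt.1 nt.2 t'.
  move=> [n t]; have [Gt|nGt] := EM (G t); last by exists t.
  by have [t' ?] := step n t Gt; exists t'.
pose c := fix c n := if n is n'.+1 then F (n', c n') else t0.
have Gc n : G (c n) by elim: n => //= n IHn; have [] := FP (n, c n) IHn.
by exists c => n; split=> //; have [] := FP (n, c n) (Gc n).
Qed.

(** * Finite partial isomorphisms and their limits *)

Section Intertwining.
Context (A : pzRingType).
Implicit Types P Q : lmodType A.

(** A finite partial isomorphism is encoded by its graph s, which makes the
notion symmetric in P and Q; f and g extend it and its inverse. *)
Definition partial_inverse P Q (s : seq (P * Q)) (f : {linear P -> Q})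
    (g : {linear Q -> P}) : Prop :=
  {in s, forall z, f z.1 = z.2 /\ g z.2 = z.1}.

Lemma partial_inverse_sym P Q s (f : {linear P -> Q}) (g : {linear Q -> P}) :
  partial_inverse s f g -> partial_inverse [seq (z.2, z.1) | z <- s] g f.
Proof. by move=> sfg _ /mapP[z /sfg[fz gz] ->]. Qed.

Definition stage P Q : Type :=
  (seq (P * Q) * ({linear P -> Q} * {linear Q -> P}))%type.

Definition good_stage P Q (t : stage P Q) : Prop :=
  partial_inverse t.1 t.2.1 t.2.2.

Lemma good_stage0 P Q : exists t : stage P Q, good_stage t.
Proof. by exists ([::], (\0 : {linear P -> Q}, \0 : {linear Q -> P})). Qed.

(** The graphs determine the values on e i from stage i.+1 on, and these
elements generate P, so both the value of f at v and the equation g (f v) = v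
stabilise for each v. *)
Lemma stage_limit P Q (e : nat -> P) (c : nat -> stage P Q) :
  (forall v, exists n (a : 'I_n -> A), v = \sum_(i < n) a i *: e i) ->
  (forall n, good_stage (c n)) ->
  (forall n, {subset (c n).1 <= (c n.+1).1}) ->
  (forall n, e n \in [seq z.1 | z <- (c n.+1).1]) ->
  exists phi : {linear P -> Q}, forall v, exists n0, forall n, (n0 <= n)%N ->
    (c n).2.1 v = phi v /\ (c n).2.2 (phi v) = v.
Proof.
move=> eP fg sS es.
have smono m n : (m <= n)%N -> {subset (c m).1 <= (c n).1}.
  move=> /subnK <-; elim: (n - m)%N => // k IHk z /IHk; exact: sS.
have fe i n : (i < n)%N -> (c n).2.1 (e i) = (c i.+1).2.1 (e i).
  move=> lin; have /mapP[z zs ->] := es i.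
  by have [-> _] := fg _ _ zs; have [-> _] := fg _ _ (smono _ _ lin _ zs).
have gfe i n : (i < n)%N -> (c n).2.2 ((c n).2.1 (e i)) = e i.
  move=> lin; have /mapP[z zs ->] := es i.
  by have [-> ->] := fg _ _ (smono _ _ lin _ zs).
have [v|phi phiP] := limit_linear (f := fun n => (c n).2.1).
  have [m [a ->]] := eP v; exists m => n mn.
  apply: eq_on_generators => i.
  by rewrite !fe // (leq_trans (ltn_ord i)).
exists phi => v; have [n0 n0P] := phiP v; have [m [a vE]] := eP v.
exists (maxn n0 m) => n; rewrite geq_max => /andP[n0n mn].
split; first exact: n0P.
rewrite -(n0P n n0n) vE -[RHS]/(idfun _).
apply: (eq_on_generators (f := (c n).2.2 \o (c n).2.1) (g := idfun)) => i /=.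
by rewrite gfe // (leq_trans (ltn_ord i)).
Qed.

End Intertwining.

(** * Projective modules over a ring of stable rank one *)

Section StableRankOneModules.
Context (R : rngType) (srR : stable_rank_one R).
Implicit Types P Q : rmodType (dorroh R).

Definition in_rng (a : (dorroh R)^c) : Prop := (a : dorroh R).1 = 0.

Lemma stable_rank_one_converse (a b x : (dorroh R)^c) :
  in_rng (a - 1) -> a * x + b = 1 -> exists y, invertible (a + b * y).
Proof.
move=> aR xab; have [|y [v [v1 v2]]] := srR _ xab; last by exists y, v.
exists (a - 1 : dorroh R).2; move: aR; rewrite /in_rng /to_dorroh.
by case: (a - 1) => m r /= ->.
Qed.

(** As P = PR, a functional on P takes its values in (dorroh R) R = R. This is
how a condition on the ideal R alone controls endomorphisms of P. *)
Lemma CP_scalar_in_rng P (f : {scalar P}) v : CP P -> in_rng (f v).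
Proof.
case=> _ _ /(_ v)[n [q [r ->]]]; rewrite /in_rng linear_sum.
have : forall i, (f (ract (q i) (to_dorroh (r i))) : dorroh R).1 = 0.
  by move=> i; rewrite /ract linearZ /= mulr0.
elim: n q r => [|n IHn] q r fr; first by rewrite big_ord0.
by rewrite big_ord_recr /= fr IHn.
Qed.

(** A truncated dual basis sum_i h_i (-) e_i is the identity on s. Composing it
with the map that Cuntz subequivalence provides on the span of the e_i extends
the latter to all of P. *)
Lemma cuntz_finite_rank P Q (s : seq P) : CP P -> cuntz_sub P Q ->
  exists (h : nat -> {scalar P}) (q : nat -> Q) n (psi : {linear Q -> P}),
    {in s, forall v, psi (finite_rank h q n v) = v}.
Proof.
move=> [cgP projP _] PQ.
have [h [e he]] := dual_basis_seq cgP projP; have [n hen] := he s.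
have LP : linear (fun c : 'rV[(dorroh R)^c]_n => \sum_(i < n) c 0 i *: e i).
  move=> a c d; rewrite scaler_sumr -big_split.
  by apply: eq_bigr => i _; rewrite !mxE scalerDl scalerA.
pose L : {linear _ -> P} := linear_of LP.
pose E (i : 'I_n) := corestr L (delta_mx 0 i).
have EE i : submod_incl _ (E i) = e i.
  rewrite /= (bigD1 i) //= big1 => [|j ji]; rewrite mxE eqxx ?eqxx ?(negPf ji).
    by rewrite scale1r addr0.
  by rewrite scale0r.
have [|phi [psi psiphi]] := PQ (image_submod L).
  exists n, E => x; have [c <-] := corestr_surj x; exists (fun i => c 0 i).
  apply: val_inj; rewrite -[LHS]/(L c) -[val]/(submod_incl _ : _ -> _).
  by rewrite linear_sum; apply: eq_bigr => i _; rewrite linearZ EE.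
exists h, (fun i => oapp (phi \o E) 0 (insub i)), n, psi => v vs.
rewrite -[RHS](hen v vs) /= linear_sum; apply: eq_bigr => i _.
by rewrite valK linearZ /= psiphi EE.
Qed.

(** Cuntz subequivalence gives phi and psi with psi (phi v) = v at p and on the
domain of s, with no relation to f and g. The automorphism u of Q obtained from
the finite rank endomorphism phi g, with partial left inverse f psi, agrees
with phi g on the range of s, so u^-1 phi extends f there. *)
Lemma partial_inverse_extend P Q s f g (p : P) :
  CP P -> cuntz_sub P Q -> partial_inverse (Q := Q) s f g ->
  exists q f' g', partial_inverse ((p, q) :: s) f' g'.
Proof.
move=> cpP PQ sfg.
have [h [q [n [psi psiK]]]] :=
  cuntz_finite_rank (p :: [seq z.1 | z <- s]) cpP PQ.
pose phi := finite_rank h q n.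
have hg i v : in_rng ((h i \o g : {scalar Q}) v).
  by rewrite /=; apply: CP_scalar_in_rng.
have [u [w [uw wu uE]]] :=
  finite_rank_completion stable_rank_one_converse q n (f \o psi) hg.
have uphi z : z \in s -> u z.2 = phi z.1.
  move=> zs; have [fz gz] := sfg z zs.
  have aE : finite_rank (fun i => h i \o g : {scalar Q}) q n z.2 = phi z.1.
    by apply: eq_bigr => i _; rewrite /= gz.
  rewrite uE aE //= psiK ?fz // inE map_f ?orbT //.
exists (w (phi p)), (w \o phi), (psi \o u) => z.
rewrite inE => /predU1P[->|zs] /=.
  by rewrite wu psiK // mem_head.
change (w (phi z.1) = z.2 /\ psi (u z.2) = z.1).
by rewrite -uphi // uw uphi // psiK // inE map_f ?orbT.
Qed.

Lemma cuntz_sub_locally_split P Q : CP P -> cuntz_sub P Q ->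
  exists phi : {linear P -> Q}, locally_split phi.
Proof.
move=> cpP PQ; have [[e eP] _ _] := cpP.
have [|c cP] := dependent_chain (E := fun n t t' =>
    {subset t.1 <= t'.1} /\ e n \in [seq z.1 | z <- t'.1]) (good_stage0 P Q).
  move=> n [s [f g]] sfg.
  have [q [f' [g' sfg']]] := partial_inverse_extend (e n) cpP PQ sfg.
  exists ((e n, q) :: s, (f', g')); split=> //; split; last exact: mem_head.
  by move=> z zs; rewrite inE zs orbT.
have [|n||phi phiP] := stage_limit (c := c) eP.
- by move=> n; have [] := cP n.
- by have [_ []] := cP n.
- by move=> n; have [_ []] := cP n.
exists phi => s; have [n nP] := eventually_seq s phiP.
by exists (c n).2.2 => v vs; have [] := nP n (leqnn n) v vs.
Qed.

(** Back and forth: each step first adds a generator of P, then one of Q with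
the roles of the two modules exchanged. The limits of the two sequences of maps
are inverse to each other. *)
Lemma cuntz_equiv_isomorphic P Q : CP P -> CP Q -> cuntz_equiv P Q ->
  isomorphic P Q.
Proof.
move=> cpP cpQ [PQ QP]; have [[e eP] _ _] := cpP; have [[d dQ] _ _] := cpQ.
have [|c cP] := dependent_chain (E := fun n t t' => [/\ {subset t.1 <= t'.1},
    e n \in [seq z.1 | z <- t'.1] & d n \in [seq z.2 | z <- t'.1]])
    (good_stage0 P Q).
  move=> n [s [f g]] sfg.
  have [q [f1 [g1 /partial_inverse_sym sfg1]]] :=
    partial_inverse_extend (e n) cpP PQ sfg.
  have [p [g2 [f2 /partial_inverse_sym]]] :=
    partial_inverse_extend (d n) cpQ QP sfg1.
  have sK : [seq (z.2, z.1) | z <- [seq (z.2, z.1) | z <- s]] = s.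
    by rewrite -map_comp map_id_in // => -[].
  rewrite /= sK => sfg2.
  exists ((p, d n) :: (e n, q) :: s, (f2, g2)); split=> //.
  split=> [z zs||] /=; by rewrite !inE ?zs ?eqxx ?orbT.
have [|n||phi phiP] := stage_limit (c := c) eP.
- by move=> n; have [] := cP n.
- by have [_ []] := cP n.
- by move=> n; have [_ []] := cP n.
pose c' n : stage Q P :=
  ([seq (z.2, z.1) | z <- (c n).1], ((c n).2.2, (c n).2.1)).
have [n|n|n|psi psiP] := stage_limit (c := c') dQ.
- by apply: partial_inverse_sym; have [] := cP n.
- move=> _ /mapP[z zs ->]; apply: map_f; have [_ [sS _ _]] := cP n.
  exact: sS.
- by rewrite -map_comp; have [_ []] := cP n.
exists phi; exists psi => v.
- have [[n1 P1] [n2 P2]] := (phiP v, psiP (phi v)).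
  have [_ gv] := P1 _ (leq_maxl n1 n2).
  by have [<- _] := P2 _ (leq_maxr n1 n2).
- have [[n1 P1] [n2 P2]] := (psiP v, phiP (psi v)).
  have [_ fv] := P1 _ (leq_maxl n1 n2).
  by have [<- _] := P2 _ (leq_maxr n1 n2).
Qed.

Lemma locally_split_cuntz_sub P Q (phi : {linear P -> Q}) :
  locally_split phi -> cuntz_sub P Q.
Proof.
move=> phis X [n [x xX]].
have [psi psiK] := phis [seq submod_incl X (x i) | i <- enum 'I_n].
exists (phi \o submod_incl X), psi => v; have [a ->] := xX v.
rewrite -[LHS]/((psi \o (phi \o submod_incl X)) _).
apply: eq_on_generators => i /=.
by apply: psiK; apply/mapP; exists i; rewrite ?mem_enum.
Qed.

End StableRankOneModules.

Theorem theorem1 (R : rngType) (srR : stable_rank_one R)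
    (P Q : rmodType (dorroh R)) (cpP : CP P) (cpQ : CP Q) :
  (cuntz_sub P Q <->
     exists N : submodClosed Q, pure N /\ isomorphic P (submod N))
  /\ (cuntz_equiv P Q <-> isomorphic P Q).
Proof.
split; split.
- move=> /(cuntz_sub_locally_split srR cpP)[phi phis].
  have [isoP splitN] := locally_split_corestr phis.
  exists (image_submod phi); split=> // X.
  exact: tensor_map_locally_split.
- case=> N [pureN isoP]; have [cgQ projQ _] := cpQ.
  have [h [e he]] := dual_basis_seq cgQ projQ.
  have [f fs] := locally_split_iso isoP (pure_locally_split he pureN).
  exact: locally_split_cuntz_sub fs.
- exact: cuntz_equiv_isomorphic.
- case=> f /bij_linear_inverse[g [fK gK]].
  split.
  + apply: (locally_split_cuntz_sub (phi := f)) => s.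
    by exists g => v _; apply: fK.
  + apply: (locally_split_cuntz_sub (phi := g)) => s.
    by exists f => v _; apply: gK.
Qed.
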